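(* Let $g$ be a non-empty list of natural numbers with $0$ not occurring in $g$, and let $M$ be the submonoid of $(\mathbb{N},+)$ generated by the elements of $g$ (the set of all finite $\mathbb{N}$-linear combinations of elements of $g$). Then for every $d \in M$ there exists $n \in \mathbb{N}$ with $\mathrm{mgen}_g(n) = d$.
   Context: For $m \in \mathbb{N}$, $\mathrm{next}_m$ on lists of naturals is defined by: $\mathrm{next}_m([\,]) = [0]$; $\mathrm{next}_m(h :: t) = (h+1) :: t$ if $h < m$; if $h \ge m$: $\mathrm{next}_m(h :: t) = [\,]$ when $\mathrm{next}_m(t) = [\,]$, and $=x :: x :: t'$ when $\mathrm{next}_m(t) = x :: t'$. $\mathrm{lgen}_m(0) = [\,]$, $\mathrm{lgen}_m(x+1) = \mathrm{next}_m(\mathrm{lgen}_m(x))$. For a list $g$, $g[i]$ is its $i$-th element (indexing from $0$) and $|g|$ its length. Define $\mathrm{mgen}_g(n) = \sum_{i \in \mathrm{lgen}_{|g|-1}(n)} g[i]$, where the sum runs over the elements of the list $\mathrm{lgen}_{|g|-1}(n)$ counted with multiplicity. *)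

(* Defs.v *)
From mathcomp Require Import all_boot.

Set Implicit Arguments.
Unset Strict Implicit.
Unset Printing Implicit Defensive.

Fixpoint lnext (m : nat) (s : seq nat) : seq nat :=
  match s with
  | [::] => [:: 0]
  | h :: t =>
      if h < m then h.+1 :: t
      else if lnext m t is x :: t' then x :: x :: t' else [::]
  end.

Fixpoint lgen (m n : nat) : seq nat :=
  if n is x.+1 then lnext m (lgen m x) else [::].

(* For nonempty g all entries of lgen (size g).-1 n are below size g, so the  *)
(* default value of nth is never used.                                        *)
Definition mgen (g : seq nat) (n : nat) : nat :=
  \sum_(i <- lgen (size g).-1 n) nth 0 g i.

(* Membership in the submonoid of (nat, +) generated by the elements of g;    *)
(* gen_submonoid_min and the lemmas before it show that the linear            *)
(* combinations form the least submonoid containing g.                        *)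
Definition gen_submonoid (g : seq nat) (d : nat) : Prop :=
  exists c : 'I_(size g) -> nat, d = \sum_(i < size g) c i * nth 0 g i.

Lemma gen_submonoid0 (g : seq nat) : gen_submonoid g 0.
Proof. by exists (fun=> 0); rewrite big1. Qed.

Lemma gen_submonoidD (g : seq nat) (a b : nat) :
  gen_submonoid g a -> gen_submonoid g b -> gen_submonoid g (a + b).
Proof.
move=> [c ->] [c' ->]; exists (fun i => c i + c' i).
by rewrite -big_split; apply: eq_bigr => i _; rewrite mulnDl.
Qed.

Lemma gen_submonoid_mem (g : seq nat) (a : nat) : a \in g -> gen_submonoid g a.
Proof.
move=> ag; have lt_ag : index a g < size g by rewrite index_mem.
exists (fun i => i == Ordinal lt_ag).
rewrite (bigD1 (Ordinal lt_ag)) //= eqxx mul1n nth_index // big1 ?addn0 //.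
by move=> i /negbTE ->.
Qed.

Lemma gen_submonoid_min (g : seq nat) (N : nat -> Prop) :
  N 0 -> (forall a b, N a -> N b -> N (a + b)) -> (forall a, a \in g -> N a) ->
  forall d, gen_submonoid g d -> N d.
Proof.
move=> N0 ND Ng d [c ->]; apply: big_ind => // i _.
have Ni : N (nth 0 g i) by apply/Ng/mem_nth.
by elim: (c i) => [|k IHk]; rewrite ?mul0n // mulSn; apply: ND.
Qed.

(* Main.v *)
Require Import Defs.
From mathcomp Require Import all_boot.
From mathcomp Require Import zify.

(** The lists [lgen m n] run through all nonincreasing lists with entries at
    most [m]: every nonempty such list is [lnext m] of another one whose value
    in base [m.+2] (head least significant, each entry [h] read as the digit
    [h.+1]) is smaller. An element of the submonoid is a sum over some multiset
    of indices, which can be listed in nonincreasing order. *)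

Fixpoint base_value (m : nat) (s : seq nat) : nat :=
  if s is h :: t then h.+1 + m.+2 * base_value m t else 0.

Lemma lnext_pred (m : nat) (s : seq nat) :
  s != [::] -> sorted geq s -> all (geq m) s ->
  exists p, [/\ sorted geq p, all (geq m) p, lnext m p = s
              & base_value m p < base_value m s].
Proof.
elim: s => [//|h [_|x t IH]] _.
  case: h => [|k] _; first by exists [::].
  move=> /= /andP[km _].
  by exists [:: k]; split; rewrite /= ?km //; lia.
move=> /= /andP[xh st] /and3P[hm xm tm].
(* A head above the next entry can be lowered by one, keeping the order; equal entries mean that a
   carry must be undone. *)
case: (ltngtP x h) xh => // [ltxh _|eqxh _].
  case: h ltxh hm => // k xk km; exists [:: k, x & t].
  by split; rewrite /= ?km ?st ?xm ?tm //; lia.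
have [||p [sp pm np vp]] := IH isT; [by [] | by rewrite /= xm tm |].
(* The head [m] forces the carry, which doubles the head [x] of [lnext m p]. Its digit [m.+1] is
   below the base, so the drop in the tail prevails. *)
exists (m :: p); split; rewrite /= ?leqnn ?ltnn ?np ?eqxh //.
- by case: p sp pm {np vp} => //= y p -> /andP[-> _].
- by move: vp; rewrite /= eqxh; nia.
Qed.

Lemma lgen_surj (m : nat) (s : seq nat) :
  sorted geq s -> all (geq m) s -> exists n, lgen m n = s.
Proof.
have [k] := ubnP (base_value m s).
elim: k s => // k IH s vs ss sm.
have [->|s0] := eqVneq s [::]; first by exists 0.
have [p [sp pm np vp]] := lnext_pred _ _ s0 ss sm.
by have [|n pn] := IH p _ sp pm; [lia | exists n.+1; rewrite /= pn].
Qed.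

(** Concatenating index lists adds their sums, so minimality of the submonoid applies. *)
Lemma gen_submonoid_index_sum (g : seq nat) (d : nat) :
  gen_submonoid g d ->
  exists2 s, all (gtn (size g)) s & \sum_(i <- s) nth 0 g i = d.
Proof.
move: d; apply: gen_submonoid_min => [|a b [s sg <-] [t tg <-]|a ag].
- by exists [::]; rewrite ?big_nil.
- by exists (s ++ t); rewrite ?all_cat ?sg ?big_cat.
- by exists [:: index a g]; rewrite /= ?big_seq1 ?nth_index ?index_mem ?ag.
Qed.

Theorem theorem8 (g : seq nat) (g_neq0 : g <> [::]) (g_no0 : 0 \notin g) :
  forall d : nat, gen_submonoid g d -> exists n : nat, mgen g n = d.
Proof.
move=> d /gen_submonoid_index_sum[s sg <-].
have geq_total : total geq by move=> x y; exact: leq_total.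
have [||n ns] := @lgen_surj (size g).-1 (sort geq s).
- exact: sort_sorted.
- by rewrite all_sort; apply: sub_all sg => i /=; lia.
- by exists n; rewrite /mgen ns; apply: perm_big; rewrite perm_sort.
Qed.
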